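(* There is an algorithm that, given an instance of the game Nemesis whose underlying graph is a tree, decides in time linear in the size of the graph which player has a winning strategy; likewise there is such a linear-time algorithm for instances whose underlying graph is a (simple) graph of maximum degree at most $3$.
   Context: Nemesis is a two-player game. An instance consists of a finite graph (or multigraph) $G=(V,E)$, a set $X\subseteq V$ of vertices called exits (other vertices are regular), and a starting vertex $s\in V$ for the first player, the fugitive. The game proceeds in rounds: in each round the fugitive first moves from his current vertex $x$ to an adjacent vertex $y$ along an edge $xy$ still present in the graph; then the second player, the Nemesis, permanently removes exactly one edge chosen anywhere in the current graph (for a multigraph, removing one copy of an edge decreases its multiplicity by one). The fugitive wins if he reaches an exit; the Nemesis wins if the fugitive ends up in a connected component of the current graph containing no exit. Solving an instance means deciding which player has a winning strategy from the given starting vertex. *)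

(* Defs.v *)
From HB Require Import structures.
From mathcomp Require Import all_boot all_order.

Set Implicit Arguments.
Unset Strict Implicit.
Unset Printing Implicit Defensive.

(* An edge of a simple graph is a two-element set of vertices. *)
Definition adj (V : finType) (E : {set {set V}}) : rel V :=
  fun x y => [set x; y] \in E.

(* Edges still present and vertex of the fugitive, at the start of a round. *)
Definition position (V : finType) : Type := ({set {set V}} * V)%type.

Definition escaped (V : finType) (X : {set V}) (p : position V) : bool :=
  p.2 \in X.

Definition trapped (V : finType) (X : {set V}) (p : position V) : bool :=
  [forall z in X, ~~ connect (adj p.1) p.2 z].

(* Strategies depend on the whole history, a nonempty list of positions with
   the current one first.  The Nemesis also sees the vertex to which the
   fugitive has just moved. *)
Definition fugitive_strategy (V : finType) : Type := seq (position V) -> V.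
Definition nemesis_strategy (V : finType) : Type :=
  seq (position V) -> V -> {set V}.

(* Every play that continues the history and follows sigma consists of legal
   moves and ends with an escape.  When the fugitive moves to an exit he has
   already won; this is recorded at the next position, since the edge removed
   in between does not change his vertex. *)
Inductive fugitive_wins_with (V : finType) (X : {set V})
    (sigma : fugitive_strategy V) : seq (position V) -> Prop :=
| FugitiveEscaped p h : escaped X p -> fugitive_wins_with X sigma (p :: h)
| FugitiveMove E x h :
    ~~ trapped X (E, x) ->
    adj E x (sigma ((E, x) :: h)) ->
    (forall e, e \in E ->
       fugitive_wins_with X sigma
         [:: (E :\ e, sigma ((E, x) :: h)), (E, x) & h]) ->
    fugitive_wins_with X sigma ((E, x) :: h).

Inductive nemesis_wins_with (V : finType) (X : {set V})
    (tau : nemesis_strategy V) : seq (position V) -> Prop :=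
| NemesisTrapped p h : trapped X p -> nemesis_wins_with X tau (p :: h)
| NemesisMove E x h :
    ~~ escaped X (E, x) ->
    (forall y, adj E x y -> tau ((E, x) :: h) y \in E) ->
    (forall y, adj E x y ->
       nemesis_wins_with X tau
         [:: (E :\ tau ((E, x) :: h) y, y), (E, x) & h]) ->
    nemesis_wins_with X tau ((E, x) :: h).

Record instance := Instance {
  nvertices : nat;
  edges : {set {set 'I_nvertices}};
  exits : {set 'I_nvertices};
  start : 'I_nvertices;
  edges_simple : forall e, e \in edges -> #|e| = 2
}.

Definition fugitive_has_winning_strategy (I : instance) : Prop :=
  exists sigma, fugitive_wins_with (exits I) sigma [:: (edges I, start I)].

Definition nemesis_has_winning_strategy (I : instance) : Prop :=
  exists tau, nemesis_wins_with (exits I) tau [:: (edges I, start I)].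

(* A ucycle of length at most 2 is a loop or an edge traversed back and forth. *)
Definition is_tree (I : instance) : Prop :=
  (forall x y, connect (adj (edges I)) x y) /\
  (forall c, 2 < size c -> ~ ucycle (adj (edges I)) c).

Definition degree (I : instance) (x : 'I_(nvertices I)) : nat :=
  #|[set y | adj (edges I) x y]|.

Definition max_degree_le (d : nat) (I : instance) : Prop :=
  forall x : 'I_(nvertices I), degree x <= d.

Definition graph_size (I : instance) : nat := nvertices I + #|edges I|.

(* Algorithms are while-programs for a random access machine whose memory
   consists of numbered arrays of natural numbers; a program mentions only
   finitely many arrays.  Arithmetic is restricted to successor, predecessor
   and comparison: after t steps every stored value is bounded by the largest
   input value plus O(t), so that in linear time all words have O(log n) bits
   and unit cost is justified. *)
Definition memory : Type := nat -> nat -> nat.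

Inductive expr :=
| Const of nat
| Read of nat & expr
| Succ of expr
| Pred of expr
| ELt of expr & expr
| EEq of expr & expr.

Inductive cmd :=
| Skip
| Store of nat & expr & expr
| Seq of cmd & cmd
| If of expr & cmd & cmd
| While of expr & cmd.

Fixpoint eval (m : memory) (e : expr) : nat :=
  match e with
  | Const c => c
  | Read a i => m a (eval m i)
  | Succ e1 => (eval m e1).+1
  | Pred e1 => (eval m e1).-1
  | ELt e1 e2 => eval m e1 < eval m e2
  | EEq e1 e2 => eval m e1 == eval m e2
  end.

Definition update (m : memory) (a i v : nat) : memory :=
  fun b j => if (b == a) && (j == i) then v else m b j.

(* exec p m t m': started in memory m, p halts in memory m' after t steps.
   A step is a store, a test or a skip; the sizes of the expressions evaluated in a
   step are bounded by the program, hence only affect the constant factor. *)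
Inductive exec : cmd -> memory -> nat -> memory -> Prop :=
| ExecSkip m : exec Skip m 1 m
| ExecStore a i e m :
    exec (Store a i e) m 1 (update m a (eval m i) (eval m e))
| ExecSeq c1 c2 m m1 m2 t1 t2 :
    exec c1 m t1 m1 -> exec c2 m1 t2 m2 -> exec (Seq c1 c2) m (t1 + t2) m2
| ExecIfTrue e c1 c2 m m1 t :
    eval m e != 0 -> exec c1 m t m1 -> exec (If e c1 c2) m t.+1 m1
| ExecIfFalse e c1 c2 m m1 t :
    eval m e = 0 -> exec c2 m t m1 -> exec (If e c1 c2) m t.+1 m1
| ExecWhileTrue e c m m1 m2 t1 t2 :
    eval m e != 0 -> exec c m t1 m1 -> exec (While e c) m1 t2 m2 ->
    exec (While e c) m (t1 + t2).+1 m2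
| ExecWhileFalse e c m : eval m e = 0 -> exec (While e c) m 1 m.

(* The neighbours of each vertex may be listed in any order. *)
Definition adjacency_lists (I : instance)
    (nbrs : 'I_(nvertices I) -> seq 'I_(nvertices I)) : Prop :=
  forall x, uniq (nbrs x) /\ (forall y, (y \in nbrs x) = adj (edges I) x y).

(* Input layout: array 0 holds the number of vertices and the starting vertex,
   array 2 the concatenated adjacency lists, array 1 their offsets (the
   neighbours of v occupy the cells offset v, ..., offset v.+1 - 1 of array 2),
   array 3 the indicator of the exits.  All other cells are 0. *)
Definition input_memory (I : instance)
    (nbrs : 'I_(nvertices I) -> seq 'I_(nvertices I)) : memory :=
  let rows := [seq [seq val u | u <- nbrs v] | v <- enum 'I_(nvertices I)] in
  let arrays :=
    [:: [:: nvertices I; val (start I)];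
        [seq sumn (take i (shape rows)) | i <- iota 0 (nvertices I).+1];
        flatten rows;
        [seq nat_of_bool (v \in exits I) | v <- enum 'I_(nvertices I)]] in
  fun a i => nth 0 (nth [::] arrays a) i.

(* The answer is read from cell 0 of array 0: 1 for the fugitive, 0 for the
   Nemesis. *)
Definition decides_winner (p : cmd) (c : nat) (I : instance) : Prop :=
  forall nbrs : 'I_(nvertices I) -> seq 'I_(nvertices I), adjacency_lists nbrs ->
  exists (t : nat) (m : memory),
    [/\ exec p (input_memory nbrs) t m,
        t <= c * graph_size I &
        (m 0 0 = 1 /\ fugitive_has_winning_strategy I) \/
        (m 0 0 = 0 /\ nemesis_has_winning_strategy I)].

Definition linear_time_solvable (class : instance -> Prop) : Prop :=
  exists (p : cmd) (c : nat), forall I : instance,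
    class I -> decides_winner p c I.

(* Main.v *)
Require Import Defs.
From mathcomp Require Import all_boot all_order.
From mathcomp Require Import zify.

Set Implicit Arguments.
Unset Strict Implicit.
Unset Printing Implicit Defensive.

(* Spread an infection from the exits to every vertex with two infected
   neighbours, and let q list the infected vertices in order of infection.
   A vertex outside q has at most one neighbour in q, so if the fugitive stands
   at a regular vertex without infected neighbours the Nemesis can always cut
   the only dangerous edge of the vertex he moves to.  Conversely, orient the
   edges from an infected vertex towards its earlier infected neighbours.  In a
   tree, or when all degrees are at most 3, the branches below an infected
   vertex share no edge, so a single removal spoils at most one of two branches
   and the fugitive descends to an exit.  Hence the fugitive wins iff he starts
   at an exit or next to an infected vertex, which a queue with infection
   counters decides in linear time, with the same program for both classes. *)

(** * Edge removal and explicit strategies for the two players *)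

Lemma adj_sym (V : finType) (E : {set {set V}}) : symmetric (adj E).
Proof. by move=> x y; rewrite /adj setUC. Qed.

Lemma adj_subset (V : finType) (E F : {set {set V}}) x y :
  E \subset F -> adj E x y -> adj F x y.
Proof. by move/subsetP=> sEF /sEF. Qed.

Lemma connect_adj_subset (V : finType) (E F : {set {set V}}) x y :
  E \subset F -> connect (adj E) x y -> connect (adj F) x y.
Proof.
by move=> sEF; apply: connect_sub => u v /(adj_subset sEF); exact: connect1.
Qed.

(* The fugitive has just arrived at x and it is the Nemesis's turn to move. *)
Fixpoint escapes_within (V : finType) (X : {set V}) (k : nat)
    (E : {set {set V}}) (x : V) : bool :=
  (x \in X) ||
  if k is k'.+1 then
    [forall e in E, exists y, adj (E :\ e) x y && escapes_within X k' (E :\ e) y]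
  else false.

(** With no edges left the condition on removals is vacuous, hence [E != set0]. Otherwise the answer
    to any one removal gives an edge to follow, and paths of the smaller graph persist in the larger
    one. *)
Lemma escapes_within_connect (V : finType) (X : {set V}) k E x :
  E != set0 -> escapes_within X k E x ->
  exists2 z, z \in X & connect (adj E) x z.
Proof.
elim: k E x => [|k IHk] E x E0 /=.
  by rewrite orbF => xX; exists x => //; exact: connect0.
case/orP => [xX|]; first by exists x => //; exact: connect0.
have /set0Pn[e eE] := E0.
move/forall_inP/(_ e eE)/existsP => [y /andP[xy yk]].
have sE : E :\ e \subset E by exact: subD1set.
have E'0 : E :\ e != set0 by apply/set0Pn; exists [set x; y].
have [z zX yz] := IHk _ _ E'0 yk.
exists z => //; apply: connect_trans (connect1 (adj_subset sE xy)) _.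
exact: connect_adj_subset sE yz.
Qed.

(* The number of remaining rounds is read off the length of the history. *)
Definition escape_strategy (V : finType) (X : {set V}) (k : nat)
    (x0 : V) : fugitive_strategy V :=
  fun h => if h is (E, x) :: h' then
    odflt x [pick y | adj E x y && escapes_within X (k - size h') E y]
  else x0.

Lemma escapes_within_not_trapped (V : finType) (X : {set V}) k E x y :
  adj E x y -> escapes_within X k E y -> ~~ trapped X (E, x).
Proof.
move=> xy yk; have E0 : E != set0 by apply/set0Pn; exists [set x; y].
have [z zX yz] := escapes_within_connect E0 yk.
apply/negP => /forall_inP/(_ z zX)/negP; apply.
exact: connect_trans (connect1 _) yz.
Qed.

Lemma escape_strategyP (V : finType) (X : {set V}) k x0 j h E x y :
  k = j + size h -> adj E x y -> escapes_within X j E y ->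
  let y' := escape_strategy X k x0 ((E, x) :: h) in
  adj E x y' /\ escapes_within X j E y'.
Proof.
move=> -> xy yj /=; rewrite addnK.
by case: pickP => [y' /andP[]|/(_ y)] //; rewrite xy yj.
Qed.

Lemma escape_strategy_wins (V : finType) (X : {set V}) k x0 j h E x :
  k = j + size h ->
  x \in X \/ (exists2 y, adj E x y & escapes_within X j E y) ->
  fugitive_wins_with X (escape_strategy X k x0) ((E, x) :: h).
Proof.
elim: j h E x => [|j IHj] h E x kE [xX|[y xy yj]]; try exact: FugitiveEscaped;
  have [xy' yj'] := escape_strategyP x0 kE xy yj;
  apply: FugitiveMove (escapes_within_not_trapped xy yj) xy' _ => e eE.
  by apply: FugitiveEscaped; rewrite /= orbF in yj'.
apply: IHj; first by rewrite kE /= addSnnS.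
case/orP: yj' => [|/forall_inP/(_ e eE)/existsP[z /andP[yz zj]]]; first by left.
by right; exists z.
Qed.

(** The default [[set x; y]], the edge just traversed, keeps the removal legal. *)
Definition cut_strategy (V : finType) (q : seq V) : nemesis_strategy V :=
  fun h y => if h is (E, x) :: _ then
    if [pick w in q | adj E y w] is Some w then [set y; w] else [set x; y]
  else set0.

(** Each move leads outside [q], to a vertex with at most one edge into [q], and that edge is cut,
    which restores the invariant. Edges run out, and a fugitive without moves satisfies
    [NemesisMove] vacuously. *)
Lemma cut_strategy_wins (V : finType) (X : {set V}) (E0 : {set {set V}})
    (q : seq V) h (E : {set {set V}}) x :
  {subset X <= q} ->
  (forall v w1 w2, v \notin q -> w1 \in q -> w2 \in q ->
     adj E0 v w1 -> adj E0 v w2 -> w1 = w2) ->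
  E \subset E0 -> x \notin X -> {in q, forall w, ~~ adj E x w} ->
  nemesis_wins_with X (cut_strategy q) ((E, x) :: h).
Proof.
move=> Xq q1; have [n] := ubnP #|E|.
elim: n h E x => // n IHn h E x En sE xX xq.
have tauE y : adj E x y -> cut_strategy q ((E, x) :: h) y \in E.
  by move=> xy /=; case: pickP => [w /andP[]|].
apply: NemesisMove => // y xy.
have yq : y \notin q by apply: contraL xy => /xq.
apply: IHn.
- by move: En; rewrite (cardsD1 (cut_strategy q ((E, x) :: h) y) E) tauE.
- exact: subset_trans (subD1set _ _) sE.
- by apply: contra yq => /Xq.
move=> w wq; apply/negP; rewrite /adj !inE.
move=> /andP[/eqP]; rewrite /cut_strategy.
case: pickP => [w' /andP[w'q yw'] /= ne yw|/(_ w) /=].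
  by apply: ne; rewrite (q1 y w w') // /adj (subsetP sE).
by rewrite wq /adj /= => ->.
Qed.

(* The order in which vertices are infected when infection starts at the exits
   and spreads to every vertex with two infected neighbours. *)
Record percolation_order (V : finType) (X : {set V}) (E : {set {set V}})
    (q : seq V) : Prop := PercolationOrder {
  percolation_exits : {subset X <= q};
  percolation_step : forall v, v \in q -> v \notin X -> exists a b,
    [/\ a != b, adj E v a, adj E v b,
        index a q < index v q & index b q < index v q];
  percolation_closed : forall v w1 w2, v \notin q -> w1 \in q -> w2 \in q ->
    adj E v w1 -> adj E v w2 -> w1 = w2 }.

(** Arcs point back in time, the way the fugitive descends; exits emit none because play ends
    there. *)
Definition infects (V : finType) (X : {set V}) (E : {set {set V}})
    (q : seq V) : rel V :=
  fun p w => [&& p \in q, p \notin X, adj E p w & index w q < index p q].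

Definition infection_edges (V : finType) (X : {set V}) (E : {set {set V}})
    (q : seq V) (u : V) : {set {set V}} :=
  [set e | [exists p, exists w, [&& connect (infects X E q) u p,
     infects X E q p w & e == [set p; w]]]].

(** * Escaping along branches that share no edge *)

Section Infection.
Variables (V : finType) (X : {set V}) (E0 : {set {set V}}) (q : seq V).
Hypothesis qP : percolation_order X E0 q.
Local Notation inf := (infects X E0 q).

Lemma connect_infects_index u p : connect inf u p -> index p q <= index u q.
Proof.
case/connectP => s; elim: s u => [|v s IHs] u /=; first by move=> _ ->.
move=> /andP[/and4P[_ _ _ vu] vs] ps.
exact: leq_trans (IHs v vs ps) (ltnW vu).
Qed.

Lemma infects_edge_inj p w p' w' :
  inf p w -> inf p' w' -> [set p; w] = [set p'; w'] -> p = p' /\ w = w'.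
Proof.
move=> /and4P[_ _ _ wp] /and4P[_ _ _ wp'] e.
have : p \in [set p'; w'] by rewrite -e set21.
have : w \in [set p'; w'] by rewrite -e set22.
have : p' \in [set p; w] by rewrite e set21.
rewrite !inE => /orP[]/eqP ? /orP[]/eqP ? /orP[]/eqP ?; subst=> //; lia.
Qed.

(** The only property through which the class of graphs enters. Branches may still meet in an exit,
    which has no outgoing arc. *)
Hypothesis disjoint_branches : forall u a b p w,
  inf u a -> inf u b -> a != b ->
  connect inf a p -> connect inf b p -> ~~ inf p w.

(** Indices orient each edge uniquely, so a common edge deeper down would have its source below both
    [a] and [b]. The edges leaving [u] do not recur, as [u] has a larger index than anything below
    it. *)
Lemma infection_edges_disjoint u a b e :
  inf u a -> inf u b -> a != b ->
  e \in [set u; a] |: infection_edges X E0 q a ->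
  e \notin [set u; b] |: infection_edges X E0 q b.
Proof.
have outside c d p w : inf u c -> inf u d -> connect inf d p -> inf p w ->
    [set u; c] != [set p; w].
  move=> uc ud dp pw; apply/eqP => /(infects_edge_inj uc pw)[up _].
  have := connect_infects_index dp; rewrite -up leqNgt.
  by case/and4P: ud => _ _ _ ->.
move=> ua ub ab; rewrite !inE negb_or.
case/orP => [/eqP->|/existsP[p /existsP[w /and3P[ap pw /eqP->]]]].
  apply/andP; split.
    by apply: contra ab => /eqP/(infects_edge_inj ua ub)[_ ->].
  apply/existsP => -[p /existsP[w /and3P[bp pw]]].
  by apply/negP; exact: outside ua ub bp pw.
rewrite eq_sym (outside b a) //=; apply/existsP => -[p' /existsP[w' /and3P[bp' pw']]].
move=> /eqP /(infects_edge_inj pw pw')[pp _]; subst p'.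
by move: (disjoint_branches w ua ub ab ap bp'); rewrite pw.
Qed.

(** One removed edge misses one of the two branches below [u]; the fugitive moves there and finds
    its edges intact. Each move lowers the index, so [k] rounds suffice. *)
Lemma infected_escapes k (E : {set {set V}}) u : u \in q -> index u q < k ->
  infection_edges X E0 q u \subset E -> escapes_within X k E u.
Proof.
elim: k E u => // k IHk E u uq uk uE /=.
case: (boolP (u \in X)) => //= uX.
apply/forall_inP => e eE.
have [a [b [ab ua ub au bu]]] := percolation_step qP uq uX.
have branch c : adj E0 u c -> index c q < index u q ->
    e \notin [set u; c] |: infection_edges X E0 q c ->
    [exists y, adj (E :\ e) u y && escapes_within X k (E :\ e) y].
  move=> uc cu; have uc' : inf u c by apply/and4P.
  rewrite in_setU1 negb_or => /andP[euc ec].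
  have cq : c \in q by rewrite -index_mem (leq_trans cu) // index_size.
  apply/existsP; exists c; rewrite /adj in_setD1 eq_sym euc (subsetP uE) /=.
    apply: IHk; rewrite ?(leq_trans cu) //.
    apply/subsetD1P; split=> //; apply: subset_trans uE; apply/subsetP => f.
    rewrite !inE => /existsP[p /existsP[w /and3P[cp pw fE]]].
    apply/existsP; exists p; apply/existsP; exists w; rewrite pw fE !andbT.
    exact: connect_trans (connect1 uc') cp.
  rewrite inE; apply/existsP; exists u; apply/existsP; exists c.
  by rewrite connect0 uc' eqxx.
have [ea|] := boolP (e \in [set u; a] |: infection_edges X E0 q a).
  apply: (branch b) => //; apply: infection_edges_disjoint ea => //; exact/and4P.
exact: branch.
Qed.

Lemma infected_neighbour_wins x :
  x \in X \/ (exists2 u, u \in q & adj E0 x u) ->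
  exists sigma, fugitive_wins_with X sigma [:: (E0, x)].
Proof.
(* Every vertex of [q] has index below [size q]. *)
move=> xP; exists (escape_strategy X (size q) x).
apply: (@escape_strategy_wins _ _ _ _ (size q)); first exact: esym (addn0 _).
case: xP => [|[u uq xu]]; [by left | right; exists u => //].
apply: infected_escapes => //; first by rewrite index_mem.
apply/subsetP => e; rewrite inE => /existsP[p /existsP[w /and3P[_ pw /eqP->]]].
by case/and4P: pw.
Qed.

End Infection.

Lemma no_infected_neighbour_loses (V : finType) (X : {set V}) E0 q x :
  percolation_order X E0 q -> x \notin X ->
  {in q, forall u, ~~ adj E0 x u} ->
  exists tau, nemesis_wins_with X tau [:: (E0, x)].
Proof.
move=> [Xq _ q1] xX xq; exists (cut_strategy q).
exact: (cut_strategy_wins [::] Xq q1 (subxx _) xX xq).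
Qed.

(** * Disjointness of branches in trees and for maximum degree 3 *)

(* Two branches below u that meet close up to a cycle through u. *)
Lemma tree_disjoint_branches (I : instance) q u a b p w :
  is_tree I ->
  let inf := infects (exits I) (edges I) q in
  inf u a -> inf u b -> a != b ->
  connect inf a p -> connect inf b p -> ~~ inf p w.
Proof.
move=> [_ acyclic] inf ua ub ab ap bp; exfalso.
(* Indices decrease below [u], so both branches live in the graph without [u]; through [p] they link
   [a] to [b] there. *)
pose r := [rel x y | [&& adj (edges I) x y, x != u & y != u]].
have r_sym : connect_sym r.
  by apply: sym_connect_sym => x y /=; rewrite adj_sym [X in _ && X]andbC.
have below c d : inf u c -> connect inf c d -> connect r c d.
  case/and4P => _ _ _ cu /connectP[s]; elim: s c cu => [|e s IHs] c cu /=.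
    by move=> _ ->; exact: connect0.
  move=> /andP[/and4P[_ _ ce ec] es] ds; have eu := ltn_trans ec cu.
  apply: connect_trans (connect1 _) (IHs e eu es ds); rewrite /= ce /=.
  by apply/andP; split; apply/eqP => eq; subst; lia.
have /connectP[s0 rs0 bs0] : connect r a b.
  by apply: connect_trans (below a p ua ap) _; rewrite r_sym; exact: below.
case/shortenP: rs0 bs0 => s rs us _ bs.
(* Since [a != b] the path is nonempty, which makes the cycle through [u] longer than 2. *)
have s_gt0 : 0 < size s by case: s bs {rs us} => //= ba; rewrite ba eqxx in ab.
have [rsE us'] : path (adj (edges I)) a s /\ u \notin s.
  elim: s a {us bs s_gt0 ab ua ap} rs => //= c s IHs a.
  move=> /andP[/and3P[ac _ cu] /IHs[-> us]].
  by rewrite inE negb_or us eq_sym cu ac.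
have ua' : u != a by case/and4P: ua => _ _ _; apply: contraL => /eqP->; rewrite ltnn.
apply: (acyclic [:: u, a & s]); first by [].
have uaE : adj (edges I) u a by case/and4P: ua.
have buE : adj (edges I) b u by rewrite adj_sym; case/and4P: ub.
apply/andP; split; first by rewrite /= rcons_path uaE rsE -bs buE.
by rewrite cons_uniq inE negb_or ua' us' us.
Qed.

(* A non-exit has two lower neighbours, which leaves room for one higher one. *)
Lemma cubic_infects_unique (I : instance) q p p' w :
  max_degree_le 3 I -> percolation_order (exits I) (edges I) q ->
  let inf := infects (exits I) (edges I) q in
  w \notin exits I -> inf p w -> inf p' w -> p = p'.
Proof.
move=> deg3 qP inf wX /and4P[pq _ pw wp] /and4P[_ _ p'w wp'].
have wq : w \in q by rewrite -index_mem (leq_trans wp) // index_size.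
have [a [b [ab wa wb aw bw]]] := percolation_step qP wq wX.
apply/eqP; apply: contraT => pp'.
have := deg3 w; rewrite leqNgt => /negP[]; rewrite /degree.
have lt_neq x y : index x q < index w q -> index w q < index y q -> x != y.
  by move=> xw wy; apply: contraTneq (ltn_trans xw wy) => ->; rewrite ltnn.
have us : uniq [:: a; b; p; p'].
  rewrite /= !inE !negb_or ab pp' /= andbT -!andbA.
  by rewrite !lt_neq.
apply: (@leq_trans #|[:: a; b; p; p']|); first by rewrite (card_uniqP us).
apply: subset_leq_card; apply/subsetP => x.
by rewrite !inE => /or4P[] /eqP->; rewrite // adj_sym.
Qed.

(** A regular vertex has at most one incoming arc, so the two descents to [p] can be traced back in
    step. If one is exhausted first, the other passes through [u] after starting below it, against
    the index order; if both are at once, then [a = b]. *)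
Lemma cubic_disjoint_branches (I : instance) q u a b p w :
  max_degree_le 3 I -> percolation_order (exits I) (edges I) q ->
  let inf := infects (exits I) (edges I) q in
  inf u a -> inf u b -> a != b ->
  connect inf a p -> connect inf b p -> ~~ inf p w.
Proof.
move=> deg3 qP inf ua ub ab ap bp; apply/negP => /and4P[_ pX _ _].
have unique := cubic_infects_unique deg3 qP.
have up c c' d : inf u c -> inf u c' -> inf d c' -> c' \notin exits I ->
    ~~ connect inf c d.
  move=> uc uc' dc' c'X; rewrite -(unique _ _ _ c'X uc' dc'); apply/negP.
  by move/connect_infects_index; case/and4P: uc => _ _ _; rewrite ltnNge => /negP.
have last_step c d : connect inf c d ->
    c = d \/ exists2 d', connect inf c d' & inf d' d.
  case/connectP => s; case/lastP: s => [|s e]; first by left.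
  rewrite rcons_path last_rcons => /andP[cs se] ->; right.
  by exists (last c s) => //; apply/connectP; exists s.
have [k] := ubnP (size q - index p q).
elim: k p ap bp pX => // k IHk p ap bp pX pk.
case: (last_step _ _ ap) (last_step _ _ bp) => [pa|[p1 ap1 p1p]] [pb|[p2 bp2 p2p]].
- by rewrite pa pb eqxx in ab.
- by rewrite -pa in pX p2p; have /negP := up _ _ _ ub ua p2p pX.
- by rewrite -pb in pX p1p; have /negP := up _ _ _ ua ub p1p pX.
rewrite -(unique _ _ _ pX p1p p2p) in bp2.
case/and4P: p1p => p1q p1X _ pp1.
apply: IHk ap1 bp2 p1X _; apply: leq_trans (pk : _ <= k).
by rewrite -index_mem in p1q; rewrite ltn_sub2l // (ltn_trans pp1).
Qed.

(** * Time-bounded correctness rules for programs *)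

Definition runs (c : cmd) (m : memory) (k : nat) (Q : memory -> Prop) : Prop :=
  exists t m', [/\ exec c m t m', t <= k & Q m'].

Lemma runs_leq c m k k' (Q : memory -> Prop) :
  k <= k' -> runs c m k Q -> runs c m k' Q.
Proof.
by move=> kk [t [m' [cm tk Qm]]]; exists t, m'; split=> //; exact: leq_trans kk.
Qed.

Lemma runs_skip m (Q : memory -> Prop) : Q m -> runs Skip m 1 Q.
Proof. by move=> Qm; exists 1, m; split=> //; exact: ExecSkip. Qed.

Lemma runs_store a i e m (Q : memory -> Prop) :
  Q (update m a (eval m i) (eval m e)) -> runs (Store a i e) m 1 Q.
Proof. by move=> Qm; eexists 1, _; split; [exact: ExecStore | |]. Qed.

Lemma runs_seq R k1 k2 c1 c2 m (Q : memory -> Prop) :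
  runs c1 m k1 R -> (forall m', R m' -> runs c2 m' k2 Q) ->
  runs (Seq c1 c2) m (k1 + k2) Q.
Proof.
move=> [t1 [m1 [cm1 tk1 Rm]]] /(_ _ Rm)[t2 [m2 [cm2 tk2 Qm]]].
by exists (t1 + t2), m2; split; [exact: ExecSeq cm2 | exact: leq_add |].
Qed.

Lemma runs_if e c1 c2 m k (Q : memory -> Prop) :
  (eval m e != 0 -> runs c1 m k Q) -> (eval m e = 0 -> runs c2 m k Q) ->
  runs (If e c1 c2) m k.+1 Q.
Proof.
move=> run1 run2; have [e0|e0] := eqVneq (eval m e) 0.
  have [t [m' [cm tk Qm]]] := run2 e0.
  by exists t.+1, m'; split=> //; exact: ExecIfFalse.
have [t [m' [cm tk Qm]]] := run1 e0.
by exists t.+1, m'; split=> //; exact: ExecIfTrue.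
Qed.

(* [P b m] bounds by b the running time of the loop entered in memory m. *)
Lemma runs_while (P : nat -> memory -> Prop) e c (Q : memory -> Prop) :
  (forall b m, P b m ->
     [/\ eval m e = 0, 0 < b & Q m] \/
     eval m e != 0 /\ exists k b', k + b' < b /\ runs c m k (P b')) ->
  forall b m, P b m -> runs (While e c) m b Q.
Proof.
move=> step b; have [n] := ubnP b; elim: n b => // n IHn b bn m.
case/step => [[e0 b0 Qm]|[e0 [k [b' [kb [t [m1 [cm tk Pm1]]]]]]]].
  by exists 1, m; split=> //; exact: ExecWhileFalse.
have b'n : b' < n by lia.
have [t2 [m2 [cm2 tk2 Qm]]] := IHn b' b'n m1 Pm1.
by exists (t + t2).+1, m2; split=> //; [exact: ExecWhileTrue cm2 | lia].
Qed.

Lemma runs_for (P : nat -> memory -> Prop) e c k N :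
  (forall j m, j <= N -> P j m -> eval m e = (j < N)) ->
  (forall j m, j < N -> P j m -> runs c m k (P j.+1)) ->
  forall m, P 0 m -> runs (While e c) m (N * k.+1).+1 (P N).
Proof.
move=> test body m P0.
pose P' b m := exists2 j, j <= N /\ b = ((N - j) * k.+1).+1 & P j m.
apply: (@runs_while P'); last by exists 0; rewrite ?subn0.
move=> b {P0}m [j [jN ->] Pj]; rewrite (test j) //.
have [ltjN|leNj] := ltnP j N; last first.
  by left; split=> //; have -> : N = j by lia.
right; split=> //; exists k, ((N - j.+1) * k.+1).+1; split.
  have -> : N - j = (N - j.+1).+1 by lia.
  by rewrite mulSn addnS addSn.
have [t [m' [cm tk Pm']]] := body _ _ ltjN Pj.
by exists t, m'; split=> //; exists j.+1.
Qed.

(** * Reading the input arrays *)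

Lemma input_exit (I : instance)
    (nbrs : 'I_(nvertices I) -> seq 'I_(nvertices I)) (v : 'I_(nvertices I)) :
  input_memory nbrs 3 v = (v \in exits I).
Proof. by rewrite /input_memory /= (nth_map v) ?size_enum_ord // nth_ord_enum. Qed.

Definition rows (I : instance) (nbrs : 'I_(nvertices I) -> seq 'I_(nvertices I)) :=
  [seq [seq val u | u <- nbrs v] | v <- enum 'I_(nvertices I)].

Lemma nth_rows (I : instance)
    (nbrs : 'I_(nvertices I) -> seq 'I_(nvertices I)) (v : 'I_(nvertices I)) :
  nth [::] (rows nbrs) v = [seq val u | u <- nbrs v].
Proof. by rewrite (nth_map v) ?size_enum_ord // nth_ord_enum. Qed.

Lemma size_rows (I : instance)
    (nbrs : 'I_(nvertices I) -> seq 'I_(nvertices I)) :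
  size (rows nbrs) = nvertices I.
Proof. by rewrite size_map size_enum_ord. Qed.

Lemma input_offset (I : instance)
    (nbrs : 'I_(nvertices I) -> seq 'I_(nvertices I)) i :
  i <= nvertices I -> input_memory nbrs 1 i = sumn (take i (shape (rows nbrs))).
Proof.
by move=> iN; rewrite /input_memory [LHS](nth_map 0) ?size_iota // nth_iota.
Qed.

Lemma input_offsetS (I : instance)
    (nbrs : 'I_(nvertices I) -> seq 'I_(nvertices I)) (v : 'I_(nvertices I)) :
  input_memory nbrs 1 v.+1 = input_memory nbrs 1 v + size (nbrs v).
Proof.
have vN : v < size (rows nbrs) by rewrite size_rows ltn_ord.
have vS : v < size (shape (rows nbrs)) by rewrite size_map.
rewrite !input_offset ?ltn_ord ?(ltnW (ltn_ord v)) // (take_nth 0) //.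
by rewrite sumn_rcons (nth_map [::]) // nth_rows size_map.
Qed.

(** The offset of [v] is the total length of the earlier rows, so splitting the concatenation before
    row [v] leaves index [j] in that row. *)
Lemma input_neighbour (I : instance)
    (nbrs : 'I_(nvertices I) -> seq 'I_(nvertices I)) (v : 'I_(nvertices I)) j :
  j < size (nbrs v) ->
  input_memory nbrs 2 (input_memory nbrs 1 v + j) = nth v (nbrs v) j.
Proof.
move=> jv; rewrite input_offset ?(ltnW (ltn_ord v)) //.
rewrite -[LHS]/(nth 0 (flatten (rows nbrs)) _).
have -> : flatten (rows nbrs) =
    flatten (take v (rows nbrs)) ++ flatten (drop v (rows nbrs)).
  by rewrite -flatten_cat cat_take_drop.
rewrite nth_cat size_flatten /shape map_take ltnNge leq_addr addKn /=.
rewrite (drop_nth [::]) ?size_rows //= nth_cat nth_rows size_map jv.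
by rewrite (nth_map v).
Qed.

(** * The queue program *)

Definition reg (k : nat) : expr := Read 6 (Const k).

(* Array 4 counts the infected neighbours found so far, array 5 is the queue of
   infected vertices; the registers are the head and the tail of the queue and
   a running index. *)
Definition push (e : expr) : cmd :=
  Seq (Store 5 (reg 1) e) (Store 6 (Const 1) (Succ (reg 1))).

Definition enqueue_exits : cmd :=
  While (ELt (reg 2) (Read 0 (Const 0)))
    (Seq (If (Read 3 (reg 2)) (push (reg 2)) Skip)
         (Store 6 (Const 2) (Succ (reg 2)))).

(** Testing for exactly 2 queues a regular vertex only once; exits are skipped since they were
    queued at the start. *)
Definition visit : cmd :=
  let w := Read 2 (reg 2) in
  Seq (Store 4 w (Succ (Read 4 w)))
    (Seq (If (EEq (Read 4 w) (Const 2)) (If (Read 3 w) Skip (push w)) Skip)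
         (Store 6 (Const 2) (Succ (reg 2)))).

Definition scan_neighbours : cmd :=
  While (ELt (reg 2) (Read 1 (Succ (Read 5 (reg 0))))) visit.

Definition percolate : cmd :=
  While (ELt (reg 0) (reg 1))
    (Seq (Store 6 (Const 2) (Read 1 (Read 5 (reg 0))))
         (Seq scan_neighbours (Store 6 (Const 0) (Succ (reg 0))))).

(** Once the queue is exhausted, the counter of [s] is the number of its infected neighbours. *)
Definition answer : cmd :=
  let s := Read 0 (Const 1) in
  If (Read 3 s) (Store 0 (Const 0) (Const 1))
     (Store 0 (Const 0) (ELt (Const 0) (Read 4 s))).

Definition nemesis_solver : cmd := Seq enqueue_exits (Seq percolate answer).

(** * Invariants, correctness and cost of the program *)

Section Solver.
Variables (I : instance) (nbrs : 'I_(nvertices I) -> seq 'I_(nvertices I)).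
Hypothesis nbrsP : adjacency_lists nbrs.
Local Notation V := 'I_(nvertices I).
Local Notation X := (exits I).
Local Notation E := (edges I).

(** [D] is a ghost list of all vertices visited so far, with repetitions, so that counters are
    multiplicities in it. *)
Record solver_state (q D : seq V) (h i : nat) (m : memory) : Prop := SolverState {
  state_input : forall a, a < 4 -> m a =1 input_memory nbrs a;
  state_count : forall v : V, m 4 v = count_mem v D;
  state_queue : forall k, k < size q -> m 5 k = nth 0 (map val q) k;
  state_head : m 6 0 = h;
  state_tail : m 6 1 = size q;
  state_index : m 6 2 = i }.

Lemma solver_state_init : solver_state [::] [::] 0 0 (input_memory nbrs).
Proof. by split=> // *; rewrite /input_memory nth_nil. Qed.

Lemma solver_state_index q D h i j m :
  solver_state q D h i m -> solver_state q D h j (update m 6 2 j).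
Proof.
move=> [mI mc mq mh mt mi]; split=> // a a4 k; rewrite /update.
by rewrite ltn_eqF ?mI // (leq_trans a4).
Qed.

Lemma solver_state_head q D h h' i m :
  solver_state q D h i m -> solver_state q D h' i (update m 6 0 h').
Proof.
move=> [mI mc mq mh mt mi]; split=> // a a4 k; rewrite /update.
by rewrite ltn_eqF ?mI // (leq_trans a4).
Qed.

Lemma solver_state_count q D h i m (w : V) : solver_state q D h i m ->
  solver_state q (rcons D w) h i (update m 4 w (m 4 w).+1).
Proof.
move=> [mI mc mq mh mt mi]; split=> //.
  by move=> a a4 k; rewrite /update ltn_eqF //= mI.
move=> v; rewrite /update /= -cats1 count_cat /= addn0 !mc.
rewrite -(inj_eq val_inj) eq_sym.
by case: eqP => [/val_inj->|_]; rewrite ?addn1 ?addn0.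
Qed.

Lemma runs_push q D h i m e (w : V) : solver_state q D h i m -> eval m e = w ->
  runs (push e) m 2 (solver_state (rcons q w) D h i).
Proof.
move=> [mI mc mq mh mt mi] ew.
apply: (@runs_seq (fun m' => m' = update m 5 (m 6 1) w) 1 1).
  by apply: runs_store; rewrite ew.
move=> _ ->; apply: runs_store; rewrite /= mt.
split; rewrite /update /= ?size_rcons ?mt //.
  by move=> a a4 k; rewrite !(ltn_eqF (leq_trans a4 _)) //= mI.
move=> k; rewrite ltnS leq_eqVlt map_rcons nth_rcons size_map.
by case: eqVneq => [->|_ /= kq]; rewrite ?ltnn ?kq ?mq.
Qed.

Lemma enqueue_exits_correct :
  runs enqueue_exits (input_memory nbrs) (nvertices I * 5).+1
    (solver_state [seq v <- enum V | v \in X] [::] 0 (nvertices I)).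
Proof.
pose P j := solver_state [seq v <- take j (enum V) | v \in X] [::] 0 j.
have -> : [seq v <- enum V | v \in X] =
    [seq v <- take (nvertices I) (enum V) | v \in X].
  by rewrite take_oversize ?size_enum_ord.
have P0 : P 0 (input_memory nbrs) by rewrite /P take0; exact: solver_state_init.
apply: (@runs_for P) => // j m jN Pm.
  by rewrite /= (state_index Pm) (state_input Pm).
pose v := Ordinal jN.
rewrite /P (take_nth v) ?size_enum_ord // (nth_ord_enum v v) filter_rcons.
set q := [seq v <- take j (enum V) | v \in X].
(* One test, two stores of [push] and the index store; the loop test makes 5. *)
apply: (@runs_seq (solver_state (if v \in X then rcons q v else q) [::] 0 j) 3 1);
  last first.
  move=> m' Pm'; apply: runs_store; rewrite /= (state_index Pm').
  exact: solver_state_index Pm'.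
apply: runs_if; rewrite /= (state_index Pm) (state_input Pm) // (input_exit nbrs v).
  case: (v \in X) => // _; apply: runs_push => //=; exact: state_index Pm.
by case: (v \in X) => // _; apply: (@runs_leq _ _ 1) => //; exact: runs_skip.
Qed.

Definition visited_queue (q D : seq V) (w : V) : seq V :=
  if (w \notin X) && (count_mem w (rcons D w) == 2) then rcons q w else q.

Lemma visit_correct q D h i m (w : V) :
  solver_state q D h i m -> input_memory nbrs 2 i = w ->
  runs visit m 6 (solver_state (visited_queue q D w) (rcons D w) h i.+1).
Proof.
(* The 6 steps are the counter store, two tests, two stores of [push] and the index store. *)
move=> Sm iw; apply: (@runs_seq (solver_state q (rcons D w) h i) 1 5).
  apply: runs_store; rewrite /= (state_index Sm) (state_input Sm) // iw.
  exact: solver_state_count Sm.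
move=> m1 Sm1.
have evw : m1 2 i = w by rewrite (state_input Sm1).
have evX : m1 3 w = (w \in X) by rewrite (state_input Sm1) // input_exit.
apply: (@runs_seq (solver_state (visited_queue q D w) (rcons D w) h i) 4 1).
  rewrite /visited_queue.
  apply: runs_if; rewrite /= (state_index Sm1) evw (state_count Sm1).
    case: (_ == 2) => // _.
    apply: runs_if; rewrite /= (state_index Sm1) evw evX.
      case: (w \in X) => // _.
      by apply: (@runs_leq _ _ 1) => //; exact: runs_skip.
    case: (w \in X) => // _; apply: runs_push => //=.
    by rewrite (state_index Sm1).
  case: (_ == 2) => // _; rewrite andbF.
  by apply: (@runs_leq _ _ 1) => //; exact: runs_skip.
move=> m2 Sm2; apply: runs_store; rewrite /= (state_index Sm2).
exact: solver_state_index Sm2.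
Qed.

(** Loop invariant: membership is tied to the counts in [D], since closure under infection is
    guaranteed only once the whole queue has been scanned. *)
Record infection_queue (q D : seq V) : Prop := InfectionQueue {
  queue_uniq : uniq q;
  queue_mem : forall v, (v \in q) = (v \in X) || (1 < count_mem v D);
  queue_step : forall v, v \in q -> v \notin X -> exists a b,
    [/\ a != b, adj E v a, adj E v b,
        index a q < index v q & index b q < index v q] }.

Lemma infection_queue_exits : infection_queue [seq v <- enum V | v \in X] [::].
Proof.
split; first by rewrite filter_uniq ?enum_uniq.
  by move=> v; rewrite mem_filter mem_enum andbT orbF.
by move=> v; rewrite mem_filter => /andP[->].
Qed.

(** When the count of [w] reaches 2, the bound by queued neighbours supplies two of them, distinct
    because the queue is duplicate-free and earlier because [w] is appended at the end. *)
Lemma infection_queue_visit q D w :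
  infection_queue q D -> count_mem w (rcons D w) <= count (adj E w) q ->
  infection_queue (visited_queue q D w) (rcons D w).
Proof.
move=> [uq qM qS]; rewrite /visited_queue -cats1 => cw.
have cD v : count_mem v (D ++ [:: w]) = count_mem v D + (w == v).
  by rewrite count_cat /= addn0.
case: ifP => [/andP[wX c2]|ncond]; last first.
  split=> // v; rewrite qM cD; case: eqVneq => [<-|_]; last by rewrite addn0.
  move: ncond; rewrite cD eqxx addn1 eqSS.
  by case: (w \in X) => //=; case: (count_mem w D) => [|[|]].
have wq : w \notin q.
  by move: c2; rewrite qM (negPf wX) cD eqxx addn1 eqSS => /eqP->.
rewrite (eqP c2) -size_filter in cw.
case fq: [seq x <- q | adj E w x] cw => [|a [|b s]] // _.
have [aq bq] : a \in [seq x <- q | adj E w x] /\ b \in [seq x <- q | adj E w x].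
  by rewrite fq !inE !eqxx orbT.
have ab : a != b.
  have := filter_uniq (adj E w) uq.
  by rewrite fq /= inE negb_or => /andP[/andP[]].
move: aq bq; rewrite !mem_filter => /andP[wa aq] /andP[wb bq].
have idx x : x \in q -> index x (rcons q w) = index x q.
  by move=> xq; rewrite -cats1 index_cat xq.
have idxw : index w (rcons q w) = size q.
  by rewrite -cats1 index_cat (negPf wq) /= eqxx addn0.
split.
- by rewrite rcons_uniq wq.
- move=> v; rewrite mem_rcons inE qM cD eq_sym.
  case: eqVneq => [<-|_]; last by rewrite addn0.
  by move: c2; rewrite cD eqxx => /eqP->; rewrite orbT.
move=> v; rewrite mem_rcons inE; case: eqVneq => [-> _ _|_ /= vq vX].
  by exists a, b; rewrite idxw !idx // !index_mem.
have [c [d [cd vc vd cv dv]]] := qS v vq vX.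
have inq x : index x q < index v q -> x \in q.
  by rewrite -index_mem => xv; rewrite (leq_trans xv) // index_size.
by exists c, d; rewrite !idx // inq.
Qed.

Lemma count_neighbours w v : count_mem w (nbrs v) = adj E w v.
Proof.
by have [uv nv] := nbrsP v; rewrite count_uniq_mem // nv adj_sym.
Qed.

Definition processed (s : seq V) : seq V := flatten [seq nbrs x | x <- s].

Lemma count_processed w s : count_mem w (processed s) = count (adj E w) s.
Proof.
rewrite /processed; elim: s => //= v s IHs.
by rewrite count_cat IHs count_neighbours.
Qed.

Lemma processed_rcons s v : processed (rcons s v) = processed s ++ nbrs v.
Proof. by rewrite /processed map_rcons flatten_rcons. Qed.

Lemma scan_neighbours_correct s v q m :
  infection_queue (s ++ v :: q) (processed s) ->
  solver_state (s ++ v :: q) (processed s) (size s) (input_memory nbrs 1 v) m ->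
  runs scan_neighbours m (size (nbrs v) * 7).+1 (fun m' => exists q' i,
    infection_queue (s ++ v :: q') (processed (rcons s v)) /\
    solver_state (s ++ v :: q') (processed (rcons s v)) (size s) i m').
Proof.
move=> Qq Sm.
pose D j := processed s ++ take j (nbrs v).
pose P j m' := exists q', infection_queue (s ++ v :: q') (D j) /\
  solver_state (s ++ v :: q') (D j) (size s) (input_memory nbrs 1 v + j) m'.
have : runs scan_neighbours m (size (nbrs v) * 7).+1 (P (size (nbrs v))).
  apply: runs_for => [j m' _ [q' [_ Sm']]|j m' jv [q' [Qq' Sm']]|].
  - rewrite /= (state_index Sm') (state_head Sm') (state_queue Sm').
      rewrite map_cat nth_cat size_map ltnn subnn /= (state_input Sm') //.
      by rewrite input_offsetS ltn_add2l.
    by rewrite size_cat /= -addSnnS leq_addr.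
  - pose w := nth v (nbrs v) j.
    have DS : D j.+1 = rcons (D j) w by rewrite /D (take_nth v) // rcons_cat.
    (* The visits so far come from the rows of [s] and part of the row of [v], all of them queued
       vertices. *)
    have cw : count_mem w (rcons (D j) w) <= count (adj E w) (s ++ v :: q').
      rewrite -DS -cat_rcons [leqRHS]count_cat -count_processed processed_rcons.
      rewrite !count_cat -addnA leq_add2l (leq_trans _ (leq_addr _ _)) //.
      by rewrite -{2}(cat_take_drop j.+1 (nbrs v)) count_cat leq_addr.
    have [t [m1 [run tk Sm1]]] := visit_correct Sm' (input_neighbour jv).
    exists t, m1; split=> //; rewrite /P DS addnS.
    have Qq1 := infection_queue_visit Qq' cw.
    have [q1 q1E] : exists q1, visited_queue (s ++ v :: q') (D j) w = s ++ v :: q1.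
      rewrite /visited_queue; case: ifP => _; last by exists q'.
      by exists (rcons q' w); rewrite rcons_cat rcons_cons.
    by exists q1; rewrite -q1E.
  by exists q; rewrite /D take0 cats0 addn0.
move=> [t [m' [run tk [q' [Qq' Sm']]]]]; exists t, m'; split=> //.
exists q', (input_memory nbrs 1 v + size (nbrs v)).
by rewrite processed_rcons; rewrite /D take_size in Qq' Sm'.
Qed.

(** The 4 covers the loop test, setting the index, the failing scan test and advancing the head; the
    7 is a visit plus its test. *)
Definition scan_cost (v : V) : nat := 4 + size (nbrs v) * 7.

(** The queue is duplicate-free, so the scan costs of the vertices outside the scanned prefix [s]
    bound the remaining time. *)
Lemma percolate_correct q i m :
  infection_queue q [::] -> solver_state q [::] 0 i m ->
  runs percolate m (\sum_v scan_cost v).+1 (fun m' => exists q' h j,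
    infection_queue q' (processed q') /\
    solver_state q' (processed q') h j m').
Proof.
move=> Qq Sm.
pose P b m := exists s q i, [/\ infection_queue (s ++ q) (processed s),
  solver_state (s ++ q) (processed s) (size s) i m &
  b = (\sum_(v | v \notin s) scan_cost v).+1].
apply: (@runs_while P); last by exists [::], q, i.
move=> b {Qq Sm q i}m [s [q [i [Qq Sm ->]]]].
rewrite /= (state_head Sm) (state_tail Sm) size_cat.
case: q Qq Sm => [|v q] Qq Sm.
  left; rewrite addn0 ltnn; split=> //; rewrite cats0 in Qq Sm.
  by exists s, (size s), i.
right; split; first by rewrite /= addnS ltnS leq_addr.
have vs : v \notin s.
  by have := queue_uniq Qq; rewrite -cat_rcons cat_uniq rcons_uniq => /and3P[/andP[]].
exists (1 + ((size (nbrs v) * 7).+1 + 1)).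
exists (\sum_(u | u \notin rcons s v) scan_cost u).+1; split.
  rewrite (bigD1 v vs) /= (eq_bigl (fun u => (u \notin s) && (u != v))) => [|u].
    by rewrite /scan_cost; move: (\sum_(_ | _) _) => r; lia.
  by rewrite mem_rcons inE negb_or andbC.
apply: (@runs_seq (solver_state (s ++ v :: q) (processed s) (size s)
    (input_memory nbrs 1 v))).
  apply: runs_store; rewrite /= (state_head Sm) (state_queue Sm) /=.
    rewrite map_cat nth_cat size_map ltnn subnn /= (state_input Sm) //.
    exact: solver_state_index Sm.
  by rewrite size_cat /= addnS ltnS leq_addr.
move=> m1 Sm1; apply: runs_seq (scan_neighbours_correct Qq Sm1) _.
move=> m2 [q' [j [Qq' Sm2]]]; apply: runs_store; rewrite /= (state_head Sm2).
exists (rcons s v), q', j; rewrite cat_rcons size_rcons; split=> //.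
exact: solver_state_head Sm2.
Qed.

(** With every row of the queue scanned, counts are numbers of infected neighbours, so a vertex left
    out has at most one. *)
Lemma infection_queue_percolation q :
  infection_queue q (processed q) -> percolation_order X E q.
Proof.
move=> [uq qM qS]; split=> // [v vX|v w1 w2]; first by rewrite qM vX.
rewrite qM negb_or -leqNgt count_processed => /andP[_ c1] w1q w2q vw1 vw2.
apply/eqP; apply: contraTT c1 => w12; rewrite -ltnNge -size_filter.
apply: (@uniq_leq_size _ [:: w1; w2]); first by rewrite /= inE w12.
by move=> w; rewrite !inE mem_filter => /orP[]/eqP->; apply/andP.
Qed.

End Solver.

(** Double counting of incidences: neighbours of [v] inject into edges at [v], and each edge has two
    ends. *)
Lemma degree_sum (I : instance) :
  \sum_(v < nvertices I) degree v <= 2 * #|edges I|.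
Proof.
have deg v : degree v <= \sum_(e in edges I | v \in e) 1.
  rewrite sum1_card /degree -(@card_in_imset _ _ (fun y => [set v; y])).
    apply: subset_leq_card; apply/subsetP => _ /imsetP[y vy ->].
    by rewrite inE in vy; apply/andP; rewrite set21.
  move=> y z; rewrite !inE => vy _ eq_vyz.
  have : y \in [set v; z] by rewrite -eq_vyz set22.
  rewrite !inE => /orP[/eqP yv|/eqP //].
  by have := edges_simple vy; rewrite yv setUid cards1.
apply: (@leq_trans (\sum_(v < nvertices I) \sum_(e in edges I | v \in e) 1)).
  by apply: leq_sum => v _; exact: deg.
rewrite (exchange_big_dep (mem (edges I))) => [|v e _ /andP[] //].
rewrite mulnC -sum_nat_const.
apply: leq_sum => e eE; rewrite -(edges_simple eE) -sum1_card.
by apply/eq_leq/eq_bigl => v; rewrite [e \in _]eE.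
Qed.

Lemma nemesis_solver_correct (I : instance) :
  (forall q u a b p w, percolation_order (exits I) (edges I) q ->
     let inf := infects (exits I) (edges I) q in
     inf u a -> inf u b -> a != b ->
     connect inf a p -> connect inf b p -> ~~ inf p w) ->
  decides_winner nemesis_solver 14 I.
Proof.
move=> disjoint nbrs nbrsP.
have [t [m [run tk win]]] : runs nemesis_solver (input_memory nbrs)
    ((nvertices I * 5).+1 + ((\sum_v scan_cost nbrs v).+1 + 2))
    (fun m => (m 0 0 = 1 /\ fugitive_has_winning_strategy I) \/
              (m 0 0 = 0 /\ nemesis_has_winning_strategy I)).
  apply: runs_seq (enqueue_exits_correct nbrs) _ => m1 Sm1.
  have Qq := infection_queue_exits I.
  apply: runs_seq (percolate_correct nbrsP Qq Sm1) _.
  move=> m2 [q [h [j [/(infection_queue_percolation nbrsP) qP Sm2]]]].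
  have fug := infected_neighbour_wins qP (fun u a b p w => @disjoint q u a b p w qP).
  have evs : m2 0 1 = start I by rewrite (state_input Sm2).
  have evX : m2 3 (start I) = (start I \in exits I).
    by rewrite (state_input Sm2) // input_exit.
  apply: runs_if; rewrite /= evs evX.
    rewrite eqb0 negbK => sX; apply: runs_store; left; split=> //.
    by apply: fug; left.
  move=> sX; have {}sX : start I \notin exits I by rewrite -eqb0 sX.
  apply: runs_store => /=.
  rewrite /update /= evs (state_count Sm2) (count_processed nbrsP) -has_count.
  case: (boolP (has _ _)) => [/hasP[u uq su]|/hasPn sq]; [left|right]; split=> //.
    by apply: fug; right; exists u.
  exact: no_infected_neighbour_loses qP sX sq.
exists t, m; split=> //; apply: leq_trans tk _.
(* Each edge accounts for at most two row entries at 7 steps each, hence the 14. *)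
have cost : \sum_v scan_cost nbrs v <= nvertices I * 4 + 14 * #|edges I|.
  rewrite big_split /= sum_nat_const card_ord leq_add2l -big_distrl /=.
  have -> : \sum_v size (nbrs v) = \sum_(v < nvertices I) degree v.
    apply: eq_bigr => v _; have [uv nv] := nbrsP v.
    by rewrite -(card_uniqP uv); apply: eq_card => y; rewrite nv inE.
  by rewrite -[14]/(2 * 7) mulnAC leq_mul2r degree_sum.
(* The start vertex makes [n = nvertices I] positive, so [9 * n + 4 <= 14 * n] absorbs the additive
   constant. *)
have := ltn_ord (start I); rewrite /graph_size.
by lia.
Qed.

Theorem theorem1 :
  linear_time_solvable is_tree /\ linear_time_solvable (max_degree_le 3).
Proof.
split; exists nemesis_solver, 14 => I clI; apply: nemesis_solver_correct.
  by move=> q u a b p w _; exact: tree_disjoint_branches.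
by move=> q u a b p w; exact: cubic_disjoint_branches.
Qed.
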